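(* Let $R$ be a ring with unity $1\neq 0$ which is not a field, and let $M$ be a left $\mathrm{SM}$ module over $R$. Then $\mathrm{Soc}(M)$ is proper essential in $M$ if and only if $M$ is not semisimple.
   Context: A left $R$-module $M$ is an $\mathrm{SM}$ module if every nontrivial (i.e. nonzero) submodule of $M$ contains a simple submodule. $\mathrm{Soc}(M)$ is the sum of all simple submodules of $M$. A submodule $E$ of $M$ is proper essential in $M$ if $E\neq\{0_M\}$, $E\neq M$, and $E\cap N\neq\{0_M\}$ for every nonzero submodule $N$ of $M$. A module is semisimple if it is a direct sum of simple submodules. *)

(* Defs.v *)
From HB Require Import structures.
From mathcomp Require Import all_boot all_algebra.
From mathcomp Require Import boolp classical_sets.

Set Implicit Arguments.
Unset Strict Implicit.
Unset Printing Implicit Defensive.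

Import GRing.Theory.

Local Open Scope classical_set_scope.
Local Open Scope ring_scope.

Definition is_field (R : nzRingType) : Prop :=
  commutative (@GRing.mul R) /\
  (forall x : R, x != 0 -> exists y : R, x * y = 1).

Section Submodules.
Variables (R : nzRingType) (M : lmodType R).
Implicit Types (E N S : set M) (F : set (set M)).

Definition submodule N : Prop := GRing.submod_closed [in N].

Definition simple_submodule S : Prop :=
  [/\ submodule S, S <> [set 0] &
      forall N, submodule N -> N `<=` S -> N = [set 0] \/ N = S].

(* The empty sum is allowed, so submodule_sum set0 = [set 0]. *)
Definition submodule_sum F : set M :=
  [set x | exists n (u : 'I_n -> M),
     (forall i, exists2 N, F N & N (u i)) /\ x = \sum_(i < n) u i].

Definition independent F : Prop :=
  forall N, F N -> N `&` submodule_sum (F `\ N) = [set 0].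

Definition Soc : set M := submodule_sum simple_submodule.

Definition SM_module : Prop :=
  forall N, submodule N -> N <> [set 0] ->
  exists2 S, simple_submodule S & S `<=` N.

Definition proper_essential E : Prop :=
  [/\ submodule E, E <> [set 0], E <> setT &
      forall N, submodule N -> N <> [set 0] -> E `&` N <> [set 0]].

(* A family of nonzero submodules whose sum is direct has no repetitions, so
   it is enough to let F be a set of submodules. The zero module is semisimple
   (F = set0). *)
Definition semisimple : Prop :=
  exists F, [/\ F `<=` simple_submodule, independent F &
                submodule_sum F = setT].

End Submodules.

Arguments Soc {R} M.
Arguments SM_module {R} M.
Arguments semisimple {R} M.

(* Main.v *)
(* A maximal independent family of simple submodules (Zorn) has sum Soc(M):
   a simple submodule meets that sum in 0 or in itself, and in the first case
   it could be added to the family.  So M is semisimple exactly when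
   Soc(M) = M.  In an SM module Soc(M) meets every nonzero submodule, and it is
   nonzero as soon as M is. *)
Require Import Defs.
From mathcomp Require Import all_boot all_algebra.
From mathcomp Require Import boolp classical_sets.

Set Implicit Arguments.
Unset Strict Implicit.
Unset Printing Implicit Defensive.

Import GRing.Theory.

Local Open Scope classical_set_scope.
Local Open Scope ring_scope.

Section SemisimpleModules.
Variables (R : nzRingType) (M : lmodType R).
Implicit Types (A B N S P : set M) (F G : set (set M)).

Lemma submoduleP N :
  submodule N <-> N 0 /\ forall (a : R) x y, N x -> N y -> N (a *: x + y).
Proof.
split=> [[/set_mem N0 NZD]|[N0 NZD]].
  by split=> // a x y Nx Ny; apply/set_mem/NZD; apply/mem_set.
split; first exact/mem_set.
by move=> a x y /set_mem Nx /set_mem Ny; apply/mem_set/NZD.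
Qed.

Lemma submodule0 N : submodule N -> N 0.
Proof. by case/submoduleP. Qed.

Lemma submoduleZD N (a : R) x y : submodule N -> N x -> N y -> N (a *: x + y).
Proof. by case/submoduleP=> _; apply. Qed.

Lemma submoduleD N x y : submodule N -> N x -> N y -> N (x + y).
Proof. by move=> sN Nx Ny; rewrite -[x]scale1r; apply: submoduleZD. Qed.

Lemma submoduleB N x y : submodule N -> N x -> N y -> N (x - y).
Proof.
by move=> sN Nx Ny; rewrite addrC -scaleN1r; apply: submoduleZD.
Qed.

Lemma submoduleT : submodule [set: M].
Proof. exact/submoduleP. Qed.

Lemma submoduleI A B : submodule A -> submodule B -> submodule (A `&` B).
Proof.
move=> sA sB; apply/submoduleP; split; first by split; apply: submodule0.
by move=> a x y [Ax Bx] [Ay By]; split; apply: submoduleZD.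
Qed.

Lemma submodule_add A B : submodule A -> submodule B ->
  submodule [set x | exists2 a, A a & exists2 b, B b & x = a + b].
Proof.
move=> sA sB; apply/submoduleP; split.
  exists 0; first exact: submodule0.
  by exists 0; [exact: submodule0|rewrite addr0].
move=> c _ _ [a Aa [b Bb ->]] [a' Aa' [b' Bb' ->]].
exists (c *: a + a'); first exact: submoduleZD.
by exists (c *: b + b'); [exact: submoduleZD|rewrite scalerDr addrACA].
Qed.

Lemma submodule_sum_ub F N : F N -> N `<=` submodule_sum F.
Proof.
by move=> FN x Nx; exists 1%N, (fun=> x); split; [exists N|rewrite big_ord1].
Qed.

(** With [submodule_sum_ub] this makes the sum a least upper bound, so later inclusions are checked
    on one member of the family at a time. *)
Lemma submodule_sum_lub F P :
  submodule P -> (forall N, F N -> N `<=` P) -> submodule_sum F `<=` P.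
Proof.
move=> sP FP _ [n [u [Fu ->]]].
elim/big_ind: _ => [|x y|i _]; [exact: submodule0|exact: submoduleD|].
by have [N FN] := Fu i; apply: FP.
Qed.

Lemma submodule_sumS F G : F `<=` G -> submodule_sum F `<=` submodule_sum G.
Proof.
move=> FG _ [n [u [Fu ->]]]; exists n, u; split=> // i.
by have [N FN Nu] := Fu i; exists N => //; apply: FG.
Qed.

Lemma submodule_submodule_sum F :
  F `<=` @submodule R M -> submodule (submodule_sum F).
Proof.
move=> sF; apply/submoduleP; split.
  by exists 0%N, (fun=> 0); split; [case|rewrite big_ord0].
move=> a _ _ [n [u [Fu ->]]] [m [v [Fv ->]]].
(* The two finite families are concatenated, with [a] absorbed into the terms of the first. *)
exists (n + m)%N, (fun i => match split i with inl j => a *: u j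
                                             | inr k => v k end).
split=> [i|].
  case: (split i) => [j|k]; last exact: Fv.
  have [N FN Nu] := Fu j; exists N => //; rewrite -[_ *: _]addr0.
  by apply: submoduleZD => //; [exact: sF|apply: submodule0; exact: sF].
rewrite big_split_ord /= scaler_sumr; congr (_ + _).
  by apply: eq_bigr => j _; rewrite (unsplitK (inl j)).
by apply: eq_bigr => k _; rewrite (unsplitK (inr k)).
Qed.

Lemma simple_submodule_submodule : @simple_submodule R M `<=` @submodule R M.
Proof. by move=> S []. Qed.

Lemma submodule_Soc : submodule (Soc M).
Proof. exact/submodule_submodule_sum/simple_submodule_submodule. Qed.

Lemma submodule_eq0 N : submodule N -> N `<=` [set 0] -> N = [set 0].
Proof.
by move=> sN N0; apply/seteqP; split=> // _ ->; apply: submodule0.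
Qed.

(** Supplies the upper bounds for Zorn's lemma: a failure of independence is witnessed by one finite
    sum, which already lives in a single member of the chain. *)
Lemma independent_bigcup (C : set (set (set M))) :
    total_on C subset ->
    (forall F, C F -> F `<=` @submodule R M /\ independent F) ->
  independent (\bigcup_(F in C) F).
Proof.
move=> totC indC N [F0 CF0 F0N]; have [sF0 _] := indC _ CF0.
have sDN F : C F -> submodule (submodule_sum (F `\ N)).
  by move=> /indC[sF _]; apply: submodule_submodule_sum => S [/sF].
have sU : submodule (submodule_sum ((\bigcup_(F in C) F) `\ N)).
  by apply: submodule_submodule_sum => S [[F /indC[sF _] /sF]].
apply: submodule_eq0; first by apply: submoduleI => //; exact: sF0.
(* The chain condition puts any element of the big sum in the sum of a single
   member of the chain that contains [N]. *)
pose P := [set x | exists F, [/\ C F, F N & submodule_sum (F `\ N) x]].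
have sP : submodule P.
  apply/submoduleP; split; first by exists F0; split=> //; apply: submodule0; exact: sDN.
  move=> a x y [F [CF FN Fx]] [G [CG GN Gy]].
  (* The larger of [F] and [G] serves as [K] for both elements. *)
  wlog [K [CK KN Kx Ky]] : / exists K, [/\ C K, K N,
      submodule_sum (K `\ N) x & submodule_sum (K `\ N) y].
    apply; have [FG|GF] := totC _ _ CF CG; [exists G|exists F]; split=> //.
      by apply: submodule_sumS Fx; apply: setSD.
    by apply: submodule_sumS Gy; apply: setSD.
  by exists K; split=> //; apply: submoduleZD => //; apply: sDN.
have UP : submodule_sum ((\bigcup_(F in C) F) `\ N) `<=` P.
  (* The member [F] containing [S] may miss [N], but [F0] contains [N], so the larger of the two
     contains both. *)
  apply: submodule_sum_lub => // S [[F CF FS] nSN] y Sy.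
  have [FF0|F0F] := totC _ _ CF CF0; [exists F0|exists F]; split=> //.
  - by apply: (submodule_sum_ub (N := S)) Sy; split=> //; apply: FF0.
  - exact: F0F.
  - exact: (submodule_sum_ub (N := S)) Sy.
move=> x [Nx /UP[F [CF FN Fx]]].
by have [_ /(_ _ FN) <-] := indC _ CF.
Qed.

(** For [N = S], what remains after removing [S] lies in [F]. Otherwise an element [x] of [N] in the
    sum of the other members is [s + y], with [s] in [S] and [y] in the sum of [F] without [N]. Then
    [s = x - y] lies in [S] and in the sum of [F], so it vanishes, and independence of [F] gives
    [x = y = 0]. *)
Lemma independent_setU1 F S :
    F `<=` @submodule R M -> submodule S -> independent F ->
    S `&` submodule_sum F = [set 0] ->
  independent (S |` F).
Proof.
move=> sF sS indF S0 N FN.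
have sSF : S |` F `<=` @submodule R M by move=> T [->|/sF].
have sFN : submodule (submodule_sum (F `\ N)).
  by apply: submodule_submodule_sum => T [/sF].
apply: submodule_eq0.
  apply: submoduleI; first exact: sSF.
  by apply: submodule_submodule_sum => T [/sSF].
have [->|/eqP nNS] := eqVneq N S.
  rewrite -S0; apply: setIS; apply: submodule_sumS => T [[->|//]] /=.
  by case.
have {}FN : F N by case: FN.
have UP : submodule_sum ((S |` F) `\ N) `<=`
    [set x | exists2 a, S a & exists2 b, submodule_sum (F `\ N) b & x = a + b].
  apply: submodule_sum_lub; first exact: submodule_add.
  move=> T [[->|FT] nTN] y Ty.
    by exists y => //; exists 0; [exact: submodule0|rewrite addr0].
  exists 0; first exact: submodule0.
  by exists y; [exact: (submodule_sum_ub (N := T)) Ty|rewrite add0r].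
move=> x [Nx /UP[s Ss [y FNy xE]]].
have s0 : s = 0.
  suff: (S `&` submodule_sum F) s by rewrite S0.
  split=> //; rewrite (_ : s = x - y); last by rewrite xE addrK.
  apply: submoduleB; first exact: submodule_submodule_sum.
    exact: (submodule_sum_ub (N := N)).
  by apply: submodule_sumS FNy => T [].
by rewrite -(indF N FN); split=> //; rewrite xE s0 add0r.
Qed.

Lemma Soc_setT_semisimple : Soc M = setT -> semisimple M.
Proof.
move=> SocT.
pose indep_simple : set (set (set M)) :=
  [set F | F `<=` @simple_submodule R M /\ independent F].
have [|F [[simF indF] maxF]] := @Zorn_bigcup _ indep_simple.
  move=> C CP totC; split; first by move=> S [F /CP[simF _] /simF].
  apply: independent_bigcup => // F /CP[simF indF]; split=> //.
  exact/(subset_trans simF)/simple_submodule_submodule.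
have sF := subset_trans simF simple_submodule_submodule.
have sSF := submodule_submodule_sum sF.
exists F; split=> //; apply/seteqP; split=> //; rewrite -SocT.
apply: submodule_sum_lub => // S simS; have [sS nS0 minS] := simS.
have [S0|<-] := minS _ (submoduleI sS sSF) (@subIsetl _ _ _);
  last exact: subIsetr.
(* Here [S] meets the sum of [F] in 0, so adjoining [S] keeps the family independent, against
   maximality. *)
exfalso; apply: (maxF (S |` F)); last first.
  by split; [move=> T [->|/simF]|exact: independent_setU1].
split=> [|SFF]; first exact: subsetUr.
(* The extension is strict: were [S] already in [F], its intersection with the sum would be [S]
   itself, forcing [S] to be zero. *)
have /submodule_sum_ub /setIidl : F S by apply: SFF; left.
by rewrite S0 => /esym.
Qed.

Lemma semisimple_Soc_setT : semisimple M -> Soc M = setT.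
Proof.
case=> F [simF _ FT]; apply/seteqP; split=> //; rewrite -FT.
exact: submodule_sumS.
Qed.

(** The empty family works; hence a module that is not semisimple is nonzero, as a nonzero socle
    requires. *)
Lemma semisimple_trivial : [set: M] = [set 0] -> semisimple M.
Proof.
move=> M0; exists set0; split=> //; rewrite M0; apply: submodule_eq0.
  exact: submodule_submodule_sum.
by rewrite -M0.
Qed.

(** A simple submodule of [N] lies in the socle too, so a zero intersection would make it zero. *)
Lemma SM_module_Soc_essential N :
  SM_module M -> submodule N -> N <> [set 0] -> Soc M `&` N <> [set 0].
Proof.
move=> hM sN N0 SN0; have [S simS SN] := hM _ sN N0; have [sS S0 _] := simS.
apply: S0; apply: submodule_eq0 => //; rewrite -SN0 subsetI; split=> //.
exact: submodule_sum_ub.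
Qed.

End SemisimpleModules.

Theorem theorem3p4 (R : nzRingType) (M : lmodType R)
  (hR : ~ is_field R) (hM : SM_module M) :
  proper_essential (Soc M) <-> ~ semisimple M.
Proof.
split=> [[_ _ SocT _] /semisimple_Soc_setT //|nssM].
have M0 : [set: M] <> [set 0] by move/semisimple_trivial.
split; first exact: submodule_Soc.
(* The socle is nonzero because it meets the nonzero submodule [setT] nontrivially. *)
- by rewrite -(setIT (Soc M)); apply/SM_module_Soc_essential/M0/submoduleT.
- by move/Soc_setT_semisimple.
- by move=> N; apply: SM_module_Soc_essential.
Qed.
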